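(* Let $f:\mathbb{R}^n\to\mathbb{R}$ satisfy AS.1, and let $\{x_k\}_{k\ge1}$ be generated by the stochastic quasi-Newton method SQN with constant batch size $m_k=\bar m$ for all $k$ (for some integer $\bar m\ge 1$) and with positive stepsizes satisfying $\sum_{k\ge1}\alpha_k=+\infty$ and $\sum_{k\ge1}\alpha_k^2<+\infty$. Assume that AS.2, AS.3 and AS.4 hold, and that there is a constant $\bar M>0$ such that $\|\nabla f(x_k)\|\le\bar M$ for all $k$. Then $$\liminf_{k\to\infty}\|\nabla f(x_k)\|=0\quad\text{with probability }1.$$
   Context: Problem: minimize a (possibly nonconvex) $f$ over $\mathbb{R}^n$, using only stochastic gradients $G(x,\xi)\in\mathbb{R}^n$ returned by a stochastic first-order oracle, where $\xi$ is a random variable whose distribution is supported on a set $\Xi\subseteq\mathbb{R}^d$ not depending on $x$. Algorithm SQN. Given: a (deterministic) point $x_1\in\mathbb{R}^n$, a positive definite $B_1\in\mathbb{R}^{n\times n}$, batch sizes $m_k\ge1$ (integers), safeguard parameters $\zeta_k$, stepsizes $\alpha_k$. For $k=1,2,\dots$: $$G_k=\frac1{m_k}\sum_{i=1}^{m_k}G(x_k,\xi_{k,i}),\qquad x_{k+1}=x_k-\alpha_k(B_k^{-1}+\zeta_kI)G_k,$$ and then a symmetric positive definite matrix $B_{k+1}$ is generated (by any rule such that AS.3 and AS.4 below hold). Write $\xi_k=(\xi_{k,1},\dots,\xi_{k,m_k})$ and $\xi_{[k]}=(\xi_1,\dots,\xi_k)$. Thus $x_{k+1}$ depends only on $\xi_{[k]}$.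 Assumptions. AS.1: $f$ is continuously differentiable, $f(x)\ge f^{low}$ for all $x\in\mathbb{R}^n$, and $\nabla f$ is globally Lipschitz with constant $L>0$. AS.2: all samples $\xi_{k,i}$ are mutually independent (so $\xi_k$ is independent of $\xi_{[k-1]}$ and hence of $x_k$), and for every $k$ and $i$, taking expectation over $\xi_{k,i}$ with $x_k$ fixed, $\mathbb{E}_{\xi_{k,i}}[G(x_k,\xi_{k,i})]=\nabla f(x_k)$ and $\mathbb{E}_{\xi_{k,i}}[\|G(x_k,\xi_{k,i})-\nabla f(x_k)\|^2]\le\sigma^2$, where $\sigma>0$. AS.3: there are positive scalars $m,M$ with $mI\preceq B_k^{-1}+\zeta_kI\preceq MI$ for all $k$. AS.4: for every $k\ge2$, the random matrix $B_k$ depends only on $\xi_{[k-1]}$. $\|\cdot\|$ is the Euclidean norm. *)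

(* Defs.v *)
From HB Require Import structures.
From mathcomp Require Import all_boot all_order all_algebra.
From mathcomp Require Import finmap.
From mathcomp Require Import all_classical all_reals all_analysis.

Set Implicit Arguments.
Unset Strict Implicit.
Unset Printing Implicit Defensive.

Import Order.TTheory GRing.Theory Num.Theory.
Import numFieldNormedType.Exports.

Local Open Scope classical_set_scope.
Local Open Scope ring_scope.

(* Vectors of R^n are column vectors 'cV[R]_n. Matrices (hence vectors) carry
   their Borel sigma-algebra. *)
HB.instance Definition _ (R : realType) (p q : nat) :=
  Measurable.copy 'M[R]_(p, q) (g_sigma_algebraType (@open 'M[R]_(p, q))).

Section euclidean_space.
Context {R : realType} {n : nat}.

(* The norm `|_| that the library puts on matrices is the sup norm. *)
Definition enorm (v : 'cV[R]_n) : R := Num.sqrt (\sum_(i < n) v i 0 ^+ 2).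

Definition grad (f : 'cV[R]_n -> R) (x : 'cV[R]_n) : 'cV[R]_n :=
  \col_i 'D_(delta_mx i 0) f x.

Definition continuously_differentiable (f : 'cV[R]_n -> R) : Prop :=
  (forall x, differentiable f x) /\ continuous (grad f).

Definition posdefmx (A : 'M[R]_n) : Prop :=
  A^T = A /\ forall v : 'cV[R]_n, v != 0 -> 0 < (v^T *m A *m v) 0 0.

Definition possemidefmx (A : 'M[R]_n) : Prop :=
  A^T = A /\ forall v : 'cV[R]_n, 0 <= (v^T *m A *m v) 0 0.

Definition loewner_le (A B : 'M[R]_n) : Prop := possemidefmx (B - A).

End euclidean_space.

Definition mutually_independent {d dU} {T : measurableType d}
    {U : measurableType dU} {R : realType} (P : probability T R)
    {I : choiceType} (D : set I) (X : I -> T -> U) : Prop :=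
  forall J : {fset I}, [set` J] `<=` D ->
  forall A : I -> set U, (forall i, measurable (A i)) ->
  P (\bigcap_(i in [set` J]) X i @^-1` A i) =
    (\prod_(i <- J) P (X i @^-1` A i))%E.

Section assumptions.
Context {R : realType} {n d : nat} {dT : measure_display}
  {T : measurableType dT} (P : probability T R).

Definition AS1 (f : 'cV[R]_n -> R) (flow L : R) : Prop :=
  [/\ continuously_differentiable f, (forall x, flow <= f x), 0 < L &
      forall x y, enorm (grad f x - grad f y) <= L * enorm (x - y)].

(* Iterations are numbered from 1, so index 0 of every sequence is unused;
   the samples of iteration k are xi k 0, ..., xi k (bsz k).-1. *)
Definition sample_index (bsz : nat -> nat) : set (nat * nat) :=
  [set p | (1 <= p.1)%N && (p.2 < bsz p.1)%N].

Definition stochastic_oracle (Xi : set 'cV[R]_d)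
    (G : 'cV[R]_n -> 'cV[R]_d -> 'cV[R]_n) : Prop :=
  measurable Xi /\
  measurable_fun ([set: 'cV[R]_n] `*` Xi)
    (fun z : 'cV[R]_n * 'cV[R]_d => G z.1 z.2).

Definition samples_supported_on (Xi : set 'cV[R]_d) (bsz : nat -> nat)
    (xi : nat -> nat -> {RV P >-> 'cV[R]_d}) : Prop :=
  forall k i, sample_index bsz (k, i) -> distribution P (xi k i) Xi = 1%E.

Definition batch_grad (G : 'cV[R]_n -> 'cV[R]_d -> 'cV[R]_n) (bsz : nat -> nat)
    (xi : nat -> nat -> {RV P >-> 'cV[R]_d}) (x : nat -> T -> 'cV[R]_n)
    (k : nat) (w : T) : 'cV[R]_n :=
  (bsz k)%:R^-1 *: \sum_(i < bsz k) G (x k w) (xi k i w).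

Definition SQN (G : 'cV[R]_n -> 'cV[R]_d -> 'cV[R]_n) (bsz : nat -> nat)
    (x1 : 'cV[R]_n) (B1 : 'M[R]_n) (zeta alpha : nat -> R)
    (xi : nat -> nat -> {RV P >-> 'cV[R]_d})
    (B : nat -> T -> 'M[R]_n) (x : nat -> T -> 'cV[R]_n) : Prop :=
  [/\ (forall k, (1 <= k)%N -> (1 <= bsz k)%N),
      (forall w, x 1%N w = x1),
      (forall w, B 1%N w = B1),
      (forall k w, (1 <= k)%N -> posdefmx (B k w)) &
      forall k w, (1 <= k)%N ->
        x k.+1 w = x k w - alpha k *:
          ((invmx (B k w) + (zeta k)%:M) *m batch_grad G bsz xi x k w)].

(* The expectation over xi k i with x k w fixed is an integral against the law
   of xi k i, whose total mass lies in Xi. In the extended reals, an integral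
   with a finite value is that of an integrable function, so the
   unbiasedness condition includes integrability. *)
Definition AS2 (f : 'cV[R]_n -> R) (sigma : R) (Xi : set 'cV[R]_d)
    (G : 'cV[R]_n -> 'cV[R]_d -> 'cV[R]_n) (bsz : nat -> nat)
    (xi : nat -> nat -> {RV P >-> 'cV[R]_d})
    (x : nat -> T -> 'cV[R]_n) : Prop :=
  [/\ 0 < sigma,
      mutually_independent P (sample_index bsz) (fun p => xi p.1 p.2),
      (forall k i, sample_index bsz (k, i) -> {ae P, forall w, forall j,
         (\int[distribution P (xi k i)]_(z in Xi) (G (x k w) z j 0)%:E)%E =
         (grad f (x k w) j 0)%:E}) &
      forall k i, sample_index bsz (k, i) -> {ae P, forall w,
        (\int[distribution P (xi k i)]_(z in Xi)
           (enorm (G (x k w) z - grad f (x k w)) ^+ 2)%:E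
         <= (sigma ^+ 2)%:E)%E}].

Definition AS3 (m M : R) (zeta : nat -> R) (B : nat -> T -> 'M[R]_n) : Prop :=
  [/\ 0 < m, 0 < M &
      {ae P, forall w, forall k, (1 <= k)%N ->
        loewner_le m%:M (invmx (B k w) + (zeta k)%:M) /\
        loewner_le (invmx (B k w) + (zeta k)%:M) M%:M}].

(* The sigma-algebra generated by the samples of iterations 1, ..., k. *)
Definition sigma_history (bsz : nat -> nat)
    (xi : nat -> nat -> {RV P >-> 'cV[R]_d}) (k : nat) : set (set T) :=
  <<s \bigcup_(p in sample_index bsz `&` [set p | (p.1 <= k)%N])
        g_sigma_algebra_preimage (xi p.1 p.2) >>.

Definition AS4 (bsz : nat -> nat) (xi : nat -> nat -> {RV P >-> 'cV[R]_d})
    (B : nat -> T -> 'M[R]_n) : Prop :=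
  forall k, (2 <= k)%N ->
    g_sigma_algebra_preimage (B k) `<=` sigma_history bsz xi k.-1.

End assumptions.

(* Main.v *)
(* By the descent lemma, conditioning on the past gives
     E f(x_{k+1}) + m alpha_k E|grad f(x_k)|^2 <= E f(x_k) + C alpha_k^2.
   Summing over k shows that the sum of alpha_k |grad f(x_k)|^2 has finite
   expectation, hence is almost surely finite; since the sum of alpha_k diverges,
   |grad f(x_k)| cannot stay away from 0. No martingale convergence theorem is
   needed, and the conditioning step is Tonelli's theorem for the joint law of
   the past and a fresh sample. *)
Require Import Defs.
From HB Require Import structures.
From mathcomp Require Import all_boot all_order all_algebra.
From mathcomp Require Import finmap.
From mathcomp Require Import ring lra.
From mathcomp Require Import all_classical all_reals all_analysis.
From mathcomp Require Import measurable_realfun.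

Set Implicit Arguments.
Unset Strict Implicit.
Unset Printing Implicit Defensive.

Import Order.TTheory GRing.Theory Num.Theory.
Import numFieldNormedType.Exports.

Local Open Scope classical_set_scope.
Local Open Scope ring_scope.

(** Two obstacles shape the argument. First, the expectations are not known to be finite in advance.
    The proof therefore works with the nonnegative [f - flow] in the extended reals and keeps the
    expected decrease next to the new iterate instead of subtracting it. Finiteness enters only
    after summation, through the deterministic starting point. Second, integrating against the law
    of a fresh sample handles one sample at a time. Jensen's inequality bounds a batch step by the
    mean of single-sample bounds, so only the independence of the past from each sample is used, and
    the constant does not shrink with the batch size. The bound [Mbar] turns the second moment of a
    stochastic gradient, at most 2 sigma^2 + 2 |grad f|^2, into a constant that the summable squares
    of the stepsizes absorb. *)

(** * Inner product and quadratic forms *)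

Section dot_product.
Context {R : realType} {n : nat}.
Implicit Types (u v w : 'cV[R]_n) (A H : 'M[R]_n) (a : R).

Definition dot u v : R := \sum_(i < n) u i 0 * v i 0.

Lemma dotC u v : dot u v = dot v u.
Proof. by apply: eq_bigr => i _; rewrite mulrC. Qed.

Lemma dotDl u v w : dot (u + v) w = dot u w + dot v w.
Proof. by rewrite /dot -big_split; apply: eq_bigr => i _; rewrite mxE mulrDl. Qed.

Lemma dotZl a u v : dot (a *: u) v = a * dot u v.
Proof. by rewrite /dot mulr_sumr; apply: eq_bigr => i _; rewrite mxE mulrA. Qed.

Lemma dotBl u v w : dot (u - v) w = dot u w - dot v w.
Proof. by rewrite -[- v]scaleN1r dotDl dotZl mulN1r. Qed.

Lemma dotDr u v w : dot u (v + w) = dot u v + dot u w.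
Proof. by rewrite dotC dotDl !(dotC u). Qed.

Lemma dotZr a u v : dot u (a *: v) = a * dot u v.
Proof. by rewrite dotC dotZl dotC. Qed.

Lemma dotBr u v w : dot u (v - w) = dot u v - dot u w.
Proof. by rewrite dotC dotBl !(dotC u). Qed.

Lemma dot0r u : dot u 0 = 0.
Proof. by rewrite -(scale0r (0 : 'cV[R]_n)) dotZr mul0r. Qed.

Lemma dot_sumr k u (v : 'I_k -> 'cV[R]_n) :
  dot u (\sum_i v i) = \sum_i dot u (v i).
Proof.
by elim/big_ind2 : _ => [|? ? ? ? <- <-|//]; rewrite ?dot0r ?dotDr.
Qed.

Lemma dot_ge0 v : 0 <= dot v v.
Proof. by apply: sumr_ge0 => i _; rewrite -expr2 sqr_ge0. Qed.

Lemma sqr_enorm v : enorm v ^+ 2 = dot v v.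
Proof.
have -> : dot v v = \sum_(i < n) v i 0 ^+ 2 by [].
by rewrite sqr_sqrtr // sumr_ge0 // => i _; rewrite sqr_ge0.
Qed.

Lemma enorm_ge0 v : 0 <= enorm v.
Proof. exact: sqrtr_ge0. Qed.

Lemma dotE u v : dot u v = (u^T *m v) 0 0.
Proof. by rewrite mxE; apply: eq_bigr => i _; rewrite mxE. Qed.

Lemma dot_mulmxr u A v : dot u (A *m v) = dot (A^T *m u) v.
Proof. by rewrite !dotE trmx_mul trmxK mulmxA. Qed.

Lemma dotD_le u v : dot (u + v) (u + v) <= 2 * dot u u + 2 * dot v v.
Proof.
have := dot_ge0 (u - v).
by rewrite !dotBl !dotBr !dotDl !dotDr (dotC v u); lra.
Qed.

(** Jensen's inequality for the squared norm: expand the nonnegative sum of the |v_i - a|^2, where a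
    is the mean. *)
Lemma dot_avg_le k (v : 'I_k -> 'cV[R]_n) : (0 < k)%N ->
  dot (k%:R^-1 *: \sum_i v i) (k%:R^-1 *: \sum_i v i)
  <= k%:R^-1 * \sum_i dot (v i) (v i).
Proof.
move=> k0; have kR : 0 < k%:R :> R by rewrite ltr0n.
set a := k%:R^-1 *: _.
have Ea : \sum_i v i = k%:R *: a by rewrite scalerA divff ?scale1r // gt_eqF.
have : 0 <= \sum_(i < k) dot (v i - a) (v i - a).
  by apply: sumr_ge0 => i _; exact: dot_ge0.
have -> : \sum_(i < k) dot (v i - a) (v i - a) =
    \sum_(i < k) dot (v i) (v i) - k%:R * dot a a.
  have E i : dot (v i - a) (v i - a) =
      dot (v i) (v i) + (- 2) * dot a (v i) + dot a a.
    by rewrite !dotBl !dotBr (dotC (v i) a); ring.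
  under eq_bigr => i _ do rewrite E.
  rewrite !big_split /= -mulr_sumr -dot_sumr Ea dotZr sumr_const card_ord.
  by rewrite -mulr_natl; ring.
by rewrite subr_ge0 ler_pdivlMl.
Qed.

Lemma loewner_scalar_le m H v : loewner_le m%:M H ->
  m * dot v v <= dot v (H *m v).
Proof.
move=> [_ /(_ v)]; rewrite -mulmxA -dotE mulmxBl dotBr mul_scalar_mx dotZr.
by rewrite subr_ge0.
Qed.

Lemma loewner_le_scalar M H v : loewner_le H M%:M ->
  dot v (H *m v) <= M * dot v v.
Proof.
move=> [_ /(_ v)]; rewrite -mulmxA -dotE mulmxBl dotBr mul_scalar_mx dotZr.
by rewrite subr_ge0.
Qed.

(** No eigenvalues are involved. With w = H v and t = 1/M, nonnegativity of the form at v - t w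
    gives 2 t |w|^2 <= v.Hv + t^2 w.Hw, and the upper bound M, applied at v and at w, turns this
    into t |w|^2 <= M |v|^2. *)
Lemma dot_mulmx_le m M H v : 0 <= m -> 0 < M ->
  loewner_le m%:M H -> loewner_le H M%:M ->
  dot (H *m v) (H *m v) <= M ^+ 2 * dot v v.
Proof.
move=> m0 M0 mH HM; have symH : H^T = H.
  have [+ _] := mH; rewrite linearB /= tr_scalar_mx.
  by move=> /addIr.
pose w := H *m v; pose t := M^-1.
have q0 : 0 <= dot (v - t *: w) (H *m (v - t *: w)).
  by apply: le_trans (loewner_scalar_le _ mH); rewrite mulr_ge0 // dot_ge0.
have Hvw : dot v (H *m w) = dot w w by rewrite dot_mulmxr symH.
move: q0; rewrite mulmxBr -scalemxAr -/w !dotBl !dotBr !dotZl !dotZr Hvw => q0.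
have q1 := loewner_le_scalar v HM; have q2 := loewner_le_scalar w HM.
have t0 : 0 < t by rewrite invr_gt0.
have Mt : M * t = 1 by rewrite divff ?gt_eqF.
have q3 : t ^+ 2 * dot w (H *m w) <= t * dot w w.
  rewrite expr2 -mulrA ler_pM2l // -[leRHS]mul1r -Mt (mulrC M) -mulrA ler_pM2l //.
have q4 : t * dot w w <= M * dot v v by rewrite -/w in q1; nra.
by rewrite -[leLHS]mul1r -Mt -mulrA expr2 -mulrA ler_pM2l.
Qed.

(** Stands in for Cauchy-Schwarz: |w - L v|^2 >= 0 bounds 2 L w.v by |w|^2 + L^2 |v|^2. *)
Lemma dot_le_of_sqr L v w : 0 < L ->
  dot w w <= L ^+ 2 * dot v v -> dot w v <= L * dot v v.
Proof.
move=> L0 wL; have := dot_ge0 (w - L *: v).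
rewrite dotBl !dotBr !dotZl !dotZr (dotC v w) => q.
have : L * dot w v <= L * (L * dot v v) by rewrite expr2 -mulrA in wL; lra.
by rewrite ler_pM2l.
Qed.

End dot_product.

(** * Gradient and descent inequality *)

Section descent.
Context {R : realType} {n : nat}.
Implicit Types (f : 'cV[R]_n -> R) (x y v : 'cV[R]_n).

Lemma diff_grad f x v : differentiable f x -> 'd f x v = dot (grad f x) v.
Proof.
move=> df; rewrite [in LHS](matrix_sum_delta v) linear_sum /=.
apply: eq_bigr => i _; rewrite big_ord1 linearZ /= mxE deriveE // mulrC.
by rewrite /GRing.scale.
Qed.

(* The constant is L instead of the optimal L / 2, which makes the mean value
   theorem sufficient. *)
Lemma descent_lemma f flow L x y : AS1 f flow L ->
  f y <= f x + dot (grad f x) (y - x) + L * dot (y - x) (y - x).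
Proof.
move=> [[df cf] _ L0 Lip]; pose v := y - x.
pose g (t : R) := f (x + t *: v).
have dg (t : R) : is_derive t (1 : R) g (dot (grad f (x + t *: v)) v).
  pose h : R -> 'cV[R]_n := cst x + ( *:%R ^~ v).
  have dh : is_diff t h (0 + ( *:%R ^~ v)).
    exact: is_diffD.
  have dgt : differentiable g t.
    by apply: (differentiable_comp _ (df (h t))); case: dh.
  apply: DeriveDef; first exact/derivable1_diffP.
  rewrite deriveE // (_ : g = f \o h) //.
  have dht : differentiable h t by case: dh.
  rewrite (diff_comp dht (df (h t))) /=.
  rewrite diff_val /= diff_grad //.
  by rewrite add0r scale1r.
have cg : {within `[0, 1], continuous g}.
  apply: continuous_subspaceT => t.
  by apply: differentiable_continuous; apply/derivable1_diffP; case: (dg t).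
have [c] := MVT (@ltr01 R) (fun t _ => dg t) cg.
rewrite in_itv /= => /andP[c0 c1].
rewrite subr0 mulr1 /g scale1r scale0r addr0 {1}/v (addrC x (y - x)) subrK => Eg.
rewrite -lerBlDl opprD addrA Eg -/v -dotBl.
set w := _ - _.
(* [w] is the change of the gradient between x and x + c v: the Lipschitz bound gives L c |v|, and c
   < 1. *)
have wL : dot w w <= L ^+ 2 * dot v v.
  have := Lip (x + c *: v) x; rewrite -/w addrAC subrr add0r => wv.
  have : enorm w ^+ 2 <= (L * enorm (c *: v)) ^+ 2.
    by rewrite ler_sqr ?nnegrE ?mulr_ge0 ?enorm_ge0 // ltW.
  rewrite exprMn !sqr_enorm dotZl dotZr mulrA -expr2 => wcv.
  apply: le_trans wcv _; rewrite ler_pM2l ?exprn_gt0 //.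
  by rewrite ler_piMl ?dot_ge0 // expr_le1 // ltW.
exact: dot_le_of_sqr.
Qed.

End descent.

(** * Borel measurability of matrix operations *)

Section measurable_matrix.
Context {R : realType} {d : measure_display} {T : measurableType d}.

Lemma measurable_invr : measurable_fun [set: R] (fun r : R => r^-1).
Proof.
(* Inversion is continuous only away from 0; the default value at 0 is handled on a measurable
   singleton. *)
have -> : [set: R] = [set r : R | r != 0] `|` [set 0].
  by apply/seteqP; split => // r _; case: (eqVneq r 0) => ?; [right|left].
have on0 : open [set r : R | r != 0] by exact: open_neq.
apply/measurable_funU => //; first exact: open_measurable.
split; last exact: measurable_fun_set1.
apply: open_continuous_measurable_fun => // r; rewrite inE => r0.
exact: inv_continuous.
Qed.

Lemma continuous_measurable_mx_real {p q} (h : 'M[R]_(p, q) -> R) :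
  continuous h -> measurable_fun [set: 'M[R]_(p, q)] h.
Proof.
move=> /continuousP ch; apply: (measurability _ (RGenOpens.measurableE R)).
move=> _ [_ [a [b ->]] <-]; rewrite setTI.
by apply: sub_sigma_algebra; apply: ch; exact: interval_open.
Qed.

Lemma continuous_measurable_mx {p q p' q'} (h : 'M[R]_(p, q) -> 'M[R]_(p', q')) :
  continuous h -> measurable_fun [set: 'M[R]_(p, q)] h.
Proof.
move=> /continuousP ch.
apply: (measurability (@open 'M[R]_(p', q'))) => // _ [A oA <-].
by rewrite setTI; apply: sub_sigma_algebra; exact: ch.
Qed.

Lemma measurable_mxP {p q} (X : T -> 'M[R]_(p, q)) :
  measurable_fun setT X <-> forall i j, measurable_fun setT (fun w => X w i j).
Proof.
split=> [mX i j|mX].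
  apply: (measurableT_comp (f := fun A : 'M[R]_(p, q) => A i j)) => //.
  by apply: continuous_measurable_mx_real; exact: coord_continuous.
apply: (measurability (@open 'M[R]_(p, q))) => // _ [U oU <-]; rewrite setTI.
(* Boxes with rational centers form a countable base. *)
pose box (A : 'M[rat]_(p, q)) (k : nat) : set 'M[R]_(p, q) :=
  [set M | forall i j, `|ratr (A i j) - M i j| < k.+1%:R^-1].
pose F (s : 'M[rat]_(p, q) * nat) : set T :=
  if `[< box s.1 s.2 `<=` U >] then X @^-1` box s.1 s.2 else set0.
have -> : X @^-1` U = \bigcup_s F s.
  apply/seteqP; split => [w /= Uw|w [s _]]; last first.
    by rewrite /F; case: asboolP => // sU; exact: sU.
  have /nbhs_ballP[e /= e0 eU] : nbhs (X w) U by exact: open_nbhs_nbhs.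
  (* Half of e, because two points of a box are compared through its center. *)
  have [k kN] : exists k, k.+1%:R^-1 < e / 2 :> R.
    have := near_infty_natSinv_lt (PosNum (divr_gt0 e0 (@ltr0n R 2))).
    by move=> [N _ /(_ _ (leqnn N))]; exists N.
  have k0 : 0 < k.+1%:R^-1 :> R by rewrite invr_gt0.
  have /all_sig2[A _ hA] (ij : 'I_p * 'I_q) :
      {r : rat | True & `|ratr r - X w ij.1 ij.2| < k.+1%:R^-1}.
    have xk : X w ij.1 ij.2 - k.+1%:R^-1 < X w ij.1 ij.2 + k.+1%:R^-1.
      by rewrite ltrD2l gtrN.
    have /cid[r] := rat_in_itvoo xk.
    rewrite in_itv /= => /andP[r1 r2]; exists r => //.
    by rewrite ltr_distl ltrBlDr in r1 *; rewrite r2 andbT.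
  exists (\matrix_(i, j) A (i, j), k) => //; rewrite /F asboolT /=.
    by move=> i j; rewrite mxE hA.
  move=> M hM; apply: eU; split => // i j.
  rewrite -ball_normE /= (le_lt_trans (ler_distD (ratr (A (i, j))) _ _)) //.
  rewrite [ltRHS]splitr ltrD //.
    by rewrite distrC (lt_trans _ kN) // (hA (i, j)).
  by rewrite (lt_trans _ kN) //; have := hM i j; rewrite mxE.
apply: countable_bigcupT_measurable => [|[A k]]; first exact: countableP.
rewrite /F; case: asboolP => // _.
rewrite (_ : X @^-1` _ = \bigcap_(ij in [set: 'I_p * 'I_q])
    ((fun w => X w ij.1 ij.2) @^-1` ball (ratr (A ij.1 ij.2) : R) k.+1%:R^-1)).
  apply: fin_bigcap_measurable => // ij _.
  by rewrite -[X in measurable X]setTI; apply: mX => //; exact: measurable_ball.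
by apply/seteqP; split => [w h [i j] _|w h i j]; [exact: h|exact: (h (i, j))].
Qed.

Lemma measurable_det {k} (X : T -> 'M[R]_k) :
  (forall i j, measurable_fun setT (fun w => X w i j)) ->
  measurable_fun setT (fun w => \det (X w)).
Proof.
move=> mX; apply: measurable_sum => s; apply: measurable_funM => //.
exact: measurable_prod.
Qed.

Lemma measurable_mulmx {p q r} (X : T -> 'M[R]_(p, q)) (Y : T -> 'M[R]_(q, r)) :
  measurable_fun setT X -> measurable_fun setT Y ->
  measurable_fun setT (fun w => X w *m Y w).
Proof.
move=> /measurable_mxP mX /measurable_mxP mY; apply/measurable_mxP => i j.
under eq_fun do rewrite mxE.
by apply: measurable_sum => k; exact: measurable_funM.
Qed.

Lemma measurable_mxD {p q} (X Y : T -> 'M[R]_(p, q)) :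
  measurable_fun setT X -> measurable_fun setT Y ->
  measurable_fun setT (fun w => X w + Y w).
Proof.
move=> /measurable_mxP mX /measurable_mxP mY; apply/measurable_mxP => i j.
by under eq_fun do rewrite mxE; exact: measurable_funD.
Qed.

Lemma measurable_mxZ {p q} a (X : T -> 'M[R]_(p, q)) :
  measurable_fun setT X -> measurable_fun setT (fun w => a *: X w).
Proof.
move=> /measurable_mxP mX; apply/measurable_mxP => i j.
by under eq_fun do rewrite mxE; exact: measurable_funM.
Qed.

Lemma measurable_mx_sum {p q k} (X : 'I_k -> T -> 'M[R]_(p, q)) :
  (forall i, measurable_fun setT (X i)) ->
  measurable_fun setT (fun w => \sum_i X i w).
Proof.
move=> mX; apply/measurable_mxP => i j.
under eq_fun do rewrite summxE.
by apply: measurable_sum => l; exact: (measurable_mxP (X l)).1.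
Qed.

(** [invmx] returns its argument on singular matrices. The invertibility test is measurable through
    the determinant, and the other branch is the cofactor formula. *)
Lemma measurable_invmx {k} (X : T -> 'M[R]_k) :
  measurable_fun setT X -> measurable_fun setT (fun w => invmx (X w)).
Proof.
move=> mX; have mXij := (measurable_mxP X).1 mX.
apply: measurable_fun_ifT => //.
  under eq_fun do rewrite unitmxE unitfE.
  apply: measurable_neg.
  by apply: measurable_fun_eqr => //; exact: measurable_det.
apply/measurable_mxP => i j.
under eq_fun do rewrite 2!mxE /cofactor.
apply: measurable_funM.
  by apply: measurableT_comp; [exact: measurable_invr|exact: measurable_det].
apply: measurable_funM => //; apply: measurable_det => a b.
by under eq_fun do rewrite !mxE; exact: mXij.
Qed.

Lemma measurable_dot {k} (X Y : T -> 'cV[R]_k) :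
  measurable_fun setT X -> measurable_fun setT Y ->
  measurable_fun setT (fun w => dot (X w) (Y w)).
Proof.
move=> /measurable_mxP mX /measurable_mxP mY.
by apply: measurable_sum => i; exact: measurable_funM.
Qed.

End measurable_matrix.

(** * Independence of generated sigma-algebras and product laws *)

Section independence.
Context {R : realType} {d dU : measure_display} {T : measurableType d}
  {U : measurableType dU} (P : probability T R).

(* A pi-lambda argument: finite intersections of cylinders generate the
   sigma-algebra of the family indexed by [S]. *)
Lemma mutually_independent_sigma {I : choiceType} (D S : set I)
    (X : I -> T -> U) (i : I) :
  mutually_independent P D X -> (forall j, measurable_fun setT (X j)) ->
  S `<=` D -> D i -> ~ S i ->
  forall E A, <<s \bigcup_(j in S) g_sigma_algebra_preimage (X j) >> E ->
    measurable A -> P (E `&` X i @^-1` A) = (P E * P (X i @^-1` A))%E.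
Proof.
move=> ind mX SD Di Si E A gE mA.
have mXi : measurable (X i @^-1` A) by rewrite -[_ @^-1` _]setTI; exact: mX.
have [r r0 Er] : exists2 r : R, 0 <= r & P (X i @^-1` A) = r%:E.
  exists (fine (P (X i @^-1` A))); first by rewrite fine_ge0.
  by rewrite fineK // fin_num_measure.
pose cyl : set (set T) := [set F | exists J : {fset I}, [set` J] `<=` S /\
  exists2 B : I -> set U, (forall j, measurable (B j)) &
    F = \bigcap_(j in [set` J]) X j @^-1` B j].
have cylT : cyl setT.
  exists fset0; split=> [j|]; first by rewrite /= inE.
  exists (fun=> setT) => //.
  by apply/seteqP; split => // w _ j _.
have cylI : setI_closed cyl.
  move=> _ _ [J1 [J1S [B1 mB1 ->]]] [J2 [J2S [B2 mB2 ->]]].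
  exists (J1 `|` J2)%fset; split.
    by move=> j /=; rewrite in_fsetU => /orP[/J1S|/J2S].
  exists (fun j => (if j \in J1 then B1 j else setT) `&`
                   (if j \in J2 then B2 j else setT)) => [j|].
    by apply: measurableI; case: ifP.
  apply/seteqP; split => [w [h1 h2] j _|w h]; split => /=.
  - by case: ifPn => // jJ; exact: h1.
  - by case: ifPn => // jJ; exact: h2.
  - by move=> j /= jJ; have := h j; rewrite /= in_fsetU jJ => /(_ isT)[].
  - by move=> j /= jJ; have := h j; rewrite /= in_fsetU jJ orbT => /(_ isT)[_].
have mcyl : cyl `<=` measurable.
  move=> _ [J [_ [B mB ->]]]; apply: fin_bigcap_measurable => // j _.
  by rewrite -[_ @^-1` _]setTI; exact: mX.
have {}gE : <<s cyl >> E.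
  apply: sub_sigma_algebra2 gE => F [j Sj [B mB <-]].
  exists [fset j]%fset; split; first by move=> k /=; rewrite inE => /eqP ->.
  exists (fun=> B) => //.
  by apply/seteqP; split => [w [_ ?] k /=|w h];
    [rewrite inE => /eqP ->|split => //; apply: (h j); rewrite /= inE].
(* As functions of [E], both sides are finite measures: a restriction of [P] and a multiple of [P].
   Hence it suffices that they agree on [cyl]. *)
rewrite Er muleC.
have -> : P (E `&` X i @^-1` A) = mrestr P mXi E by [].
have -> : (r%:E * P E)%E = mscale (NngNum r0) P E by [].
apply: (g_sigma_algebra_measure_unique cyl mcyl (fun=> setT)) => //.
- by rewrite bigcup_const.
- move=> _ [J [JS [B mB ->]]].
  (* Since [i] is outside [J], the cylinder and the event of [X i] together form a cylinder over a
     larger index set, to which [ind] applies. *)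
  have iJ : i \notin J by apply/negP => /JS.
  pose B' j := if j == i then A else B j.
  have mB' j : measurable (B' j) by rewrite /B'; case: ifP.
  have JD : [set` (i |` J)%fset] `<=` D.
    by move=> j /=; rewrite in_fset1U => /orP[/eqP ->//|/JS/SD].
  have := ind _ JD _ mB'; rewrite big_fsetU1 //= {1 2}/B' eqxx Er.
  rewrite (eq_big_seq (fun j => P (X j @^-1` B j))); last first.
    by move=> j jJ; rewrite /B'; case: eqP => // ji; rewrite -ji jJ in iJ.
  rewrite -(ind J) //; last by move=> j /JS/SD.
  rewrite /mscale /= => <-; congr (P _).
  apply/seteqP; split => [w [h1 h2] j /=|w h].
    rewrite in_fset1U /B' => /orP[/eqP ->|jJ]; first by rewrite eqxx.
    by case: eqP => [->//|_]; exact: h1.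
  split=> [j /= jJ|].
    have := h j; rewrite /= in_fset1U jJ orbT /B' => /(_ isT).
    by case: eqP => // ji; rewrite -ji jJ in iJ.
  by have := h i; rewrite /= in_fset1U /B' eqxx => /(_ isT).
- move=> k; change (P (setT `&` X i @^-1` A) < +oo)%E.
  by rewrite setTI ltey_eq fin_num_measure.
Qed.

(** Independence on rectangles makes the law of the pair the product of the two laws, by uniqueness
    of the product measure; Tonelli then integrates over [Z] first. *)
Lemma ge0_integral_indep {dV : measure_display} {V : measurableType dV}
    (Y : {mfun T >-> U}) (Z : {mfun T >-> V}) (phi : U * V -> \bar R) :
  (forall A B, measurable A -> measurable B ->
    P (Y @^-1` A `&` Z @^-1` B) = (P (Y @^-1` A) * P (Z @^-1` B))%E) ->
  measurable_fun setT phi -> (forall y, (0 <= phi y)%E) ->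
  (\int[P]_w phi (Y w, Z w) =
   \int[P]_w \int[distribution P Z]_z phi (Y w, z))%E.
Proof.
move=> ind mphi phi0.
have mYZ : measurable_fun setT (fun w => (Y w, Z w)).
  exact: measurable_fun_pair.
pose YZ : {mfun T >-> (U * V)%type} := HB.pack (fun w => (Y w, Z w))
  (isMeasurableFun.Build _ _ _ _ _ mYZ).
rewrite -[LHS](@ge0_integral_distribution _ _ _ _ _ P YZ) //.
transitivity (\int[(distribution P Y \x distribution P Z)%E]_z phi z)%E.
  apply: eq_measure_integral => A mA _.
  by apply/esym; apply: product_measure_unique => // B C mB mC; exact: ind.
rewrite fubini_tonelli1 // ge0_integral_distribution //.
  exact: measurable_fun_fubini_tonelli_F.
by move=> y; exact: integral_ge0.
Qed.

End independence.

(** * Two analytic tools: a deterministic series argument and an integral bound *)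

(** Otherwise u_k >= e > 0 from some index on; there a_k <= e^-2 a_k u_k^2, so the first series
    would be finite along with the second. *)
Lemma limn_einf_eq0 (R : realType) (a u : nat -> R) :
  (forall k, (1 <= k)%N -> 0 < a k) -> (forall k, 0 <= u k) ->
  (\sum_(1 <= k <oo) (a k)%:E = +oo)%E ->
  (\sum_(1 <= k <oo) (a k * u k ^+ 2)%:E < +oo)%E ->
  limn_einf (fun k => (u k)%:E) = 0%E.
Proof.
move=> a0 u0 ay auy.
have au0 k : (1 <= k)%N -> (0 <= (a k * u k ^+ 2)%:E)%E.
  by move=> k1; rewrite lee_fin mulr_ge0 ?sqr_ge0 // ltW // a0.
have small N e : 0 < e -> exists2 k, (N <= k)%N & u k < e.
  move=> e0; apply: contrapT => Nsmall.
  have ue k : (N <= k)%N -> e <= u k.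
    by move=> Nk; rewrite leNgt; apply/negP => uk; apply: Nsmall; exists k.
  have : (\sum_(1 <= k <oo) (a k * u k ^+ 2)%:E \is a fin_num)%E.
    rewrite ge0_fin_numE // nneseries_ge0 // => k k1 _; exact: au0.
  move=> /fineK; set S := fine _ => ES.
  (* [C] pays for the initial indices, where [u] may be below e. *)
  pose C := \sum_(1 <= k < N.+1) a k.
  have bnd j : \sum_(1 <= k < N.+1 + j) a k <=
      C + e ^- 2 * \sum_(1 <= k < N.+1 + j) a k * u k ^+ 2.
    elim: j => [|j IH].
      rewrite addn0 lerDl mulr_ge0 ?invr_ge0 ?sqr_ge0 //.
      by rewrite big_nat sumr_ge0 // => k /andP[k1 _]; rewrite -lee_fin au0.
    rewrite addnS (big_nat_recr (N.+1 + j)) // (big_nat_recr (N.+1 + j)) //=.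
    rewrite mulrDr addrA lerD //.
    rewrite mulrCA; apply: ler_peMr; first by rewrite ltW ?a0.
    rewrite ler_pdivlMl ?exprn_gt0 // mulr1.
    rewrite ler_sqr ?nnegrE ?u0 ?(ltW e0) //; apply: ue.
    by rewrite (leq_trans (leqnSn N)) ?leq_addr.
  suff : (\sum_(1 <= k <oo) (a k)%:E <= (C + e ^- 2 * S)%:E)%E.
    by rewrite ay leye_eq.
  apply: lime_le.
    by apply: is_cvg_nneseries => k k1 _; rewrite lee_fin ltW // a0.
  exists N.+1 => // K /= /subnKC <-; rewrite sumEFin lee_fin.
  apply: le_trans (bnd _) _; rewrite lerD2l ler_pM2l ?invr_gt0 ?exprn_gt0 //.
  rewrite -lee_fin -sumEFin ES.
  by apply: nneseries_lim_ge => k k1 _; exact: au0.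
have E0 : einfs (fun k => (u k)%:E) = cst 0%E.
  apply/funext => N; apply/eqP; rewrite eq_le; apply/andP; split; last first.
    by apply: le_ereal_inf_tmp => _ [k _ <-]; rewrite lee_fin.
  apply/lee_addgt0Pr => e e0; have [k Nk ke] := small N e e0.
  rewrite add0e; apply: le_trans (_ : (u k)%:E <= _)%E; last by rewrite lee_fin ltW.
  by apply: ereal_inf_lbound; exists k.
by rewrite limn_einf_lim E0 lim_cst.
Qed.

(** Averages a one-step bound over one sample: [g] is the oracle at a fixed iterate and [b] its
    mean. The linear term averages to u.b, and |g|^2 <= 2 |g - b|^2 + 2 |b|^2 reduces the second
    moment to the variance. *)
Lemma integral_quadratic_le (R : realType) (n : nat) (dV : measure_display)
    (V : measurableType dV) (mu : probability V R) (Xi : set V)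
    (g : V -> 'cV[R]_n) (u b : 'cV[R]_n) (s c0 c2 : R) (psi : V -> R) :
  measurable Xi -> mu Xi = 1%E -> measurable_fun setT g ->
  (forall j, (\int[mu]_(z in Xi) (g z j 0)%:E)%E = (b j 0)%:E) ->
  (\int[mu]_(z in Xi) (dot (g z - b) (g z - b))%:E <= s%:E)%E ->
  0 <= c2 -> measurable_fun setT psi ->
  (forall z, 0 <= psi z <= c0 - dot u (g z) + c2 * dot (g z) (g z)) ->
  (\int[mu]_(z in Xi) (psi z)%:E
    <= (c0 - dot u b + c2 * (2 * s + 2 * dot b b))%:E)%E.
Proof.
move=> mXi muXi mg gb gs c20 mpsi psi_le.
have mgj j : measurable_fun setT (fun z => g z j 0).
  exact: (measurable_mxP g).1.
pose e z := dot (g z - b) (g z - b).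
have me : measurable_fun setT e.
  by apply: measurable_dot; apply: measurable_mxD => //; exact: measurable_cst.
have e0 z : 0 <= e z by exact: dot_ge0.
have icst (c : R) : mu.-integrable Xi (EFin \o cst c).
  exact: finite_measure_integrable_cst.
have ie : mu.-integrable Xi (EFin \o e).
  apply/integrableP; split.
    by apply/measurable_EFinP; exact: measurable_funTS.
  under eq_integral => z _ do rewrite /= ger0_norm //.
  by apply: le_lt_trans gs _; rewrite ltry.
have ig j : mu.-integrable Xi (EFin \o (fun z => g z j 0)).
  (* The dominating function comes from |g_j - b_j| <= 1 + |g_j - b_j|^2 <= 1 + e. *)
  apply: (le_integrable mXi (g := fun z => ((`|b j 0| + 1)%:E + (e z)%:E)%E)).
  - by apply/measurable_EFinP; exact: measurable_funTS.
  - move=> z _ /=; rewrite lee_fin [leRHS]ger0_norm ?addr_ge0 //.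
    rewrite -[g z j 0](subrKC (b j 0)); apply: le_trans (ler_normD _ _) _.
    rewrite -addrA lerD2l.
    have : (g z j 0 - b j 0) ^+ 2 <= e z.
      rewrite /e /dot (bigD1 j) //= !mxE -expr2 lerDl sumr_ge0 // => i _.
      by rewrite -expr2 sqr_ge0.
    rewrite -real_normK ?num_real //; have := normr_ge0 (g z j 0 - b j 0).
    by move=> *; nra.
  - by apply: integrableD => //; exact: icst.
have iug : mu.-integrable Xi (EFin \o (fun z => dot u (g z))).
  rewrite (_ : _ \o _ = fun z => (\sum_(j < n) (u j 0)%:E * (g z j 0)%:E)%E).
    by apply: integrable_sum => // j _; apply: integrableZl => //; exact: ig.
  by apply/funext => z /=; rewrite -sumEFin.
have Iug : (\int[mu]_(z in Xi) (dot u (g z))%:E = (dot u b)%:E)%E.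
  transitivity (\int[mu]_(z in Xi) (\sum_(j < n) (u j 0)%:E * (g z j 0)%:E))%E.
    by apply: eq_integral => z _; rewrite -sumEFin.
  rewrite integral_sum //; last by move=> j; apply: integrableZl => //; exact: ig.
  rewrite -sumEFin; apply: eq_bigr => j _.
  by rewrite integralZl ?gb //; exact: ig.
pose c := c0 + c2 * 2 * dot b b.
pose h z := ((c)%:E - (dot u (g z))%:E + (c2 * 2)%:E * (e z)%:E)%E.
have ih1 : mu.-integrable Xi (fun z => (c%:E - (dot u (g z))%:E)%E).
  by apply: integrableB => //; exact: icst.
have ih2 : mu.-integrable Xi (fun z => ((c2 * 2)%:E * (e z)%:E)%E).
  exact: integrableZl.
have psih z : ((psi z)%:E <= h z)%E.
  rewrite /h -EFinM -EFinB -EFinD lee_fin.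
  have /andP[_ /le_trans] := psi_le z; apply.
  have := dotD_le (g z - b) b; rewrite subrK -/(e z) /c => q.
  have := ler_wpM2l c20 q; lra.
apply: (@le_trans _ _ (\int[mu]_(z in Xi) h z)%E).
  apply: ge0_le_integral => //.
  - by move=> z _; rewrite lee_fin; case/andP: (psi_le z).
  - by apply/measurable_EFinP; exact: measurable_funTS.
  - by have /integrableP[] := integrableD mXi ih1 ih2.
rewrite integralD // integralB //; last exact: icst.
have Ic : (\int[mu]_(z in Xi) (cst c%:E z) = c%:E)%E.
  by rewrite integral_cst // -[RHS]mule1; congr (_ * _)%E; exact: muXi.
rewrite Iug Ic integralZl //.
apply: le_trans (_ : c%:E - (dot u b)%:E + (c2 * 2)%:E * s%:E <= _)%E.
  by rewrite leeD2l // lee_wpmul2l // lee_fin mulr_ge0.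
by rewrite -EFinM -EFinB -EFinD lee_fin /c; lra.
Qed.

(** * One SQN step, with [Y] standing for the past and the [Z i] for the fresh samples *)

Section one_step.
Context {R : realType} {n : nat} {dT dU dV : measure_display}
  {T : measurableType dT} {U : measurableType dU} {V : measurableType dV}
  (P : probability T R) (f : 'cV[R]_n -> R) (flow L : R).
Hypothesis hf : AS1 f flow L.

Lemma AS1_measurable : measurable_fun [set: 'cV[R]_n] f.
Proof.
have [[df _] _ _ _] := hf; apply: continuous_measurable_mx_real => x.
exact/differentiable_continuous.
Qed.

Lemma AS1_measurable_grad : measurable_fun [set: 'cV[R]_n] (grad f).
Proof. by have [[_ cf] _ _ _] := hf; exact: continuous_measurable_mx. Qed.

Context (Y : {mfun T >-> U}) (X : U -> 'cV[R]_n) (H : U -> 'M[R]_n)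
  (N : nat) (Z : 'I_N -> {mfun T >-> V}) (Xi : set V)
  (g : 'cV[R]_n -> V -> 'cV[R]_n) (a m M sigma Mbar : R).
Hypotheses (mX : measurable_fun setT X) (mH : measurable_fun setT H)
  (N0 : (0 < N)%N) (mXi : measurable Xi)
  (mg : measurable_fun setT (fun z : 'cV[R]_n * V => g z.1 z.2))
  (a0 : 0 < a) (m0 : 0 < m) (M0 : 0 < M).
Hypothesis indYZ : forall i A C, measurable A -> measurable C ->
  P (Y @^-1` A `&` Z i @^-1` C) = (P (Y @^-1` A) * P (Z i @^-1` C))%E.
Hypothesis ZXi : forall i, distribution P (Z i) Xi = 1%E.
Hypothesis unbiased : forall i, {ae P, forall w, forall j,
  (\int[distribution P (Z i)]_(z in Xi) (g (X (Y w)) z j 0)%:E)%E =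
  (grad f (X (Y w)) j 0)%:E}.
Hypothesis variance_le : forall i, {ae P, forall w,
  (\int[distribution P (Z i)]_(z in Xi)
    (enorm (g (X (Y w)) z - grad f (X (Y w))) ^+ 2)%:E <= (sigma ^+ 2)%:E)%E}.
Hypothesis H_bounds : {ae P, forall w,
  loewner_le m%:M (H (Y w)) /\ loewner_le (H (Y w)) M%:M}.
Hypothesis grad_le : {ae P, forall w, enorm (grad f (X (Y w))) <= Mbar}.

Let D (v : U) : R := dot (grad f (X v)) (grad f (X v)).
(** L a^2 comes from the descent inequality, M^2 from |H g|^2 <= M^2 |g|^2, and the last factor
    bounds the second moment of a single stochastic gradient. *)
Let C : R := L * (a * M) ^+ 2 * (2 * sigma ^+ 2 + 2 * Mbar ^+ 2).

(* An upper bound for [f - flow] at the single-sample step, plus the expected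
   decrease; being nonnegative it only needs Tonelli's theorem. *)
Let psi (v : U) (z : V) : R :=
  f (X v) - flow - a * dot (grad f (X v)) (H v *m g (X v) z)
  + L * a ^+ 2 * dot (H v *m g (X v) z) (H v *m g (X v) z) + a * m * D v.

Let D0 v : 0 <= D v. Proof. exact: dot_ge0. Qed.

Let L0 : 0 < L. Proof. by case: hf. Qed.

Let C0 : 0 <= C.
Proof.
apply: mulr_ge0; first by apply: mulr_ge0; [exact: ltW|exact: sqr_ge0].
by apply: addr_ge0; apply: mulr_ge0 => //; exact: sqr_ge0.
Qed.

Let descent_step v (s : 'cV[R]_n) :
  f (X v - a *: s) - flow <=
  f (X v) - flow - a * dot (grad f (X v)) s + L * a ^+ 2 * dot s s.
Proof.
have := descent_lemma (X v) (X v - a *: s) hf.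
have -> : X v - a *: s - X v = (- a) *: s by rewrite addrAC subrr add0r scaleNr.
by rewrite !dotZr dotZl => q; lra.
Qed.

Let psi_ge0 v z : 0 <= psi v z.
Proof.
have q := descent_step v (H v *m g (X v) z).
have [_ /(_ (X v - a *: (H v *m g (X v) z))) fl _ _] := hf.
have := mulr_ge0 (mulr_ge0 (ltW a0) (ltW m0)) (D0 v).
by rewrite /psi; lra.
Qed.

Let mgrad : measurable_fun setT (fun v => grad f (X v)).
Proof. exact: (measurableT_comp AS1_measurable_grad). Qed.

Let mD : measurable_fun setT D.
Proof. exact: measurable_dot. Qed.

Let mfX : measurable_fun setT (fun v => f (X v)).
Proof. exact: (measurableT_comp AS1_measurable). Qed.

Let mpsi : measurable_fun setT (fun vz : U * V => psi vz.1 vz.2).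
Proof.
have m1 d' (W : measurableType d') (h : U -> W) : measurable_fun setT h ->
    measurable_fun setT (fun vz : U * V => h vz.1).
  by move=> mh; exact: (measurableT_comp mh).
have mHg : measurable_fun setT
    (fun vz : U * V => H vz.1 *m g (X vz.1) vz.2).
  apply: measurable_mulmx; first exact: m1.
  apply: (measurableT_comp mg (g := fun vz : U * V => (X vz.1, vz.2))).
  by apply: measurable_fun_pair; [exact: m1|exact: measurable_snd].
apply: measurable_funD; last by apply: measurable_funM => //; exact: m1.
apply: measurable_funD.
  apply: measurable_funB.
    by apply: measurable_funB => //; exact: (m1 _ _ (fun v => f (X v))).
  apply: measurable_funM => //; apply: measurable_dot => //.
  exact: (m1 _ _ (fun v => grad f (X v))).
by apply: measurable_funM => //; exact: measurable_dot.
Qed.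

(** With the past fixed, the linear term of [psi] averages to -a grad.(H grad) <= -a m |grad|^2. The
    added [a * m * D v] is cancelled by it, and only the second-order term, at most [C], remains. *)
Let integral_psi_le i :
  (\int[P]_w (psi (Y w) (Z i w))%:E <=
   \int[P]_w (f (X (Y w)) - flow + C)%:E)%E.
Proof.
have [_ fl _ _] := hf.
have mphi : measurable_fun setT (fun vz : U * V => (psi vz.1 vz.2)%:E).
  exact/measurable_EFinP.
rewrite (ge0_integral_indep (phi := fun vz => (psi vz.1 vz.2)%:E) (indYZ i)) //;
  last by move=> y; rewrite lee_fin.
apply: ae_ge0_le_integral => //.
- by move=> w _; apply: integral_ge0 => z _; rewrite lee_fin.
- apply: (measurableT_comp (measurable_fun_fubini_tonelli_F
    (m2 := distribution P (Z i)) _ mphi _)) => //.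
  by move=> y; rewrite lee_fin.
- by move=> w _; rewrite lee_fin addr_ge0 // subr_ge0.
- apply/measurable_EFinP; apply: measurable_funD => //.
  by apply: measurable_funB => //; exact: (measurableT_comp mfX).
have ub := unbiased i; have vl := variance_le i.
apply: filterS2 (filterI ub vl) (filterI H_bounds grad_le).
move=> w [ubw vlw] [[Hm HM] gw] _.
have mpsiw : measurable_fun setT (psi (Y w)).
  exact: (measurableT_comp mpsi (pair1_measurable (Y w))).
(* The oracle hypotheses concern integrals over [Xi], so its null complement is discarded first. *)
have XiC : distribution P (Z i) (~` Xi) = 0%E.
  by rewrite probability_setC // [X in (_ - X)%E]ZXi subee.
rewrite (@ge0_negligible_integral _ _ _ _ _ (~` Xi)) //; first last.
- by move=> z _; rewrite lee_fin.
- exact/measurable_EFinP.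
- exact: measurableC.
rewrite setTD setCK.
set b := grad f (X (Y w)).
have mgw : measurable_fun setT (g (X (Y w))).
  exact: (measurableT_comp mg (pair1_measurable (X (Y w)))).
(* Moving [H] across the inner product exhibits the linear term as u.g with [u] free of the
   sample. *)
apply: le_trans (integral_quadratic_le (u := a *: ((H (Y w))^T *m b))
  (c0 := f (X (Y w)) - flow + a * m * D (Y w)) (c2 := L * (a * M) ^+ 2)
  mXi (ZXi i) mgw ubw _ _ mpsiw _) _.
- by under eq_integral => z _ do rewrite -sqr_enorm; exact: vlw.
- by rewrite mulr_ge0 ?sqr_ge0 // ltW.
- move=> z; rewrite psi_ge0 /= /psi dotZl -dot_mulmxr -/b.
  have := dot_mulmx_le (g (X (Y w)) z) (ltW m0) M0 Hm HM.
  have La : 0 <= L * a ^+ 2 by rewrite mulr_ge0 ?sqr_ge0 // ltW.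
  by move=> /(ler_wpM2l La); rewrite exprMn; lra.
rewrite lee_fin dotZl -dot_mulmxr /C.
have q1 : a * m * D (Y w) <= a * dot b (H (Y w) *m b).
  by rewrite -mulrA ler_pM2l // loewner_scalar_le.
have q2 : dot b b <= Mbar ^+ 2.
  by rewrite -sqr_enorm ler_sqr ?nnegrE ?enorm_ge0 // (le_trans _ gw) ?enorm_ge0.
have q3 : L * (a * M) ^+ 2 * (2 * sigma ^+ 2 + 2 * dot b b) <=
    L * (a * M) ^+ 2 * (2 * sigma ^+ 2 + 2 * Mbar ^+ 2).
  apply: ler_wpM2l; last by rewrite lerD2l ler_pM2l.
  by apply: mulr_ge0; [exact: ltW|exact: sqr_ge0].
by lra.
Qed.

(** The descent bound is convex in the direction, so at the batch average it is at most the mean of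
    the values [psi (Y w) (Z i w)], each controlled by [integral_psi_le]. *)
Lemma expected_descent :
  (\int[P]_w (f (X (Y w) -
      a *: (H (Y w) *m (N%:R^-1 *: \sum_i g (X (Y w)) (Z i w)))) - flow)%:E +
    (a * m)%:E * \int[P]_w (dot (grad f (X (Y w))) (grad f (X (Y w))))%:E <=
   \int[P]_w (f (X (Y w)) - flow)%:E +
    (L * (a * M) ^+ 2 * (2 * sigma ^+ 2 + 2 * Mbar ^+ 2))%:E)%E.
Proof.
have [_ fl _ _] := hf; rewrite -/C.
have NR : 0 < N%:R^-1 :> R by rewrite invr_gt0 ltr0n.
have mXY : measurable_fun setT (fun w => X (Y w)) by exact: (measurableT_comp mX).
have mHY : measurable_fun setT (fun w => H (Y w)) by exact: (measurableT_comp mH).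
have mgi i : measurable_fun setT (fun w => g (X (Y w)) (Z i w)).
  apply: (measurableT_comp mg (g := fun w => (X (Y w), Z i w))).
  exact: measurable_fun_pair.
have mpsii i : measurable_fun setT (fun w => psi (Y w) (Z i w)).
  apply: (measurableT_comp mpsi (g := fun w => (Y w, Z i w))).
  exact: measurable_fun_pair.
pose x' w := X (Y w) - a *: (H (Y w) *m (N%:R^-1 *: \sum_i g (X (Y w)) (Z i w))).
have mx' : measurable_fun setT x'.
  rewrite (_ : x' = fun w => X (Y w) + (- a) *:
      (H (Y w) *m (N%:R^-1 *: \sum_i g (X (Y w)) (Z i w)))); last first.
    by apply/funext => w; rewrite /x' scaleNr.
  apply: measurable_mxD => //; apply: measurable_mxZ; apply: measurable_mulmx => //.
  by apply: measurable_mxZ; exact: measurable_mx_sum.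
have mfx' : measurable_fun setT (fun w => (f (x' w) - flow)%:E).
  apply/measurable_EFinP; apply: measurable_funB => //.
  exact: (measurableT_comp AS1_measurable).
have mDY : measurable_fun setT (fun w => (D (Y w))%:E).
  by apply/measurable_EFinP; exact: (measurableT_comp mD).
have mfXY : measurable_fun setT (fun w => (f (X (Y w)) - flow)%:E).
  apply/measurable_EFinP; apply: measurable_funB => //.
  exact: (measurableT_comp mfX).
have am0 : 0 <= a * m by rewrite mulr_ge0 // ltW.
have avgc (c : R) : N%:R^-1 * \sum_(i < N) c = c.
  by rewrite sumr_const card_ord -(mulr_natl c) mulKf // pnatr_eq0 -lt0n.
have x'_le w : f (x' w) - flow + a * m * D (Y w) <=
    N%:R^-1 * \sum_i psi (Y w) (Z i w).
  pose s i := H (Y w) *m g (X (Y w)) (Z i w).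
  have Es : H (Y w) *m (N%:R^-1 *: \sum_i g (X (Y w)) (Z i w)) =
      N%:R^-1 *: \sum_i s i by rewrite -scalemxAr mulmx_sumr.
  have := descent_step (Y w) (N%:R^-1 *: \sum_i s i).
  rewrite -{1}Es -/(x' w) => q.
  have La : 0 <= L * a ^+ 2 by rewrite mulr_ge0 ?sqr_ge0 // ltW.
  have /(ler_wpM2l La) q2 := dot_avg_le s N0.
  rewrite dotZr dot_sumr in q.
  have -> : N%:R^-1 * \sum_i psi (Y w) (Z i w) = f (X (Y w)) - flow
      - a * (N%:R^-1 * \sum_i dot (grad f (X (Y w))) (s i))
      + L * a ^+ 2 * (N%:R^-1 * \sum_i dot (s i) (s i)) + a * m * D (Y w).
    rewrite /psi !big_split /= !mulrDr !avgc sumrN mulrN -!mulr_sumr.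
    by ring.
  by lra.
have E0 : (\int[P]_w (f (x' w) - flow)%:E + (a * m)%:E * \int[P]_w (D (Y w))%:E
    = \int[P]_w (f (x' w) - flow + a * m * D (Y w))%:E)%E.
  rewrite -ge0_integralZl //; last by move=> w _; rewrite lee_fin.
  rewrite -ge0_integralD //.
  - by move=> w _; rewrite lee_fin subr_ge0.
  - by move=> w _; rewrite lee_fin mulr_ge0.
  - exact: measurable_funeM.
have E1 : (\int[P]_w (f (X (Y w)) - flow)%:E + C%:E =
    \int[P]_w (f (X (Y w)) - flow + C)%:E)%E.
  have <- : (\int[P]_w (cst C%:E w) = C%:E)%E.
    by rewrite integral_cst // -[RHS]mule1; congr (_ * _)%E; exact: probability_setT.
  by rewrite -ge0_integralD // => w _; rewrite lee_fin subr_ge0.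
rewrite E1; change (\int[P]_w (f (x' w) - flow)%:E +
  (a * m)%:E * \int[P]_w (D (Y w))%:E <=
  \int[P]_w (f (X (Y w)) - flow + C)%:E)%E; rewrite E0.
apply: (@le_trans _ _ (\int[P]_w ((N%:R^-1)%:E *
    \sum_(i <- index_enum 'I_N) (psi (Y w) (Z i w))%:E))%E).
  apply: ge0_le_integral => //.
  - by move=> w _; rewrite lee_fin addr_ge0 ?subr_ge0 // mulr_ge0.
  - apply/measurable_EFinP; apply: measurable_funD; first exact/measurable_EFinP.
    by apply: measurable_funM => //; exact/measurable_EFinP.
  - apply: measurable_funeM; apply: emeasurable_sum => i.
    exact/measurable_EFinP.
  - by move=> w _; rewrite sumEFin -EFinM lee_fin.
have mpsiE i : measurable_fun setT (fun w => (psi (Y w) (Z i w))%:E).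
  exact/measurable_EFinP.
have psiE0 i w : setT w -> (0 <= (psi (Y w) (Z i w))%:E)%E.
  by rewrite lee_fin.
rewrite ge0_integralZl //; first last.
- by move=> w _; apply: sume_ge0 => i _; exact: psiE0.
- exact: emeasurable_sum.
rewrite ge0_integral_sum //.
apply: le_trans (lee_wpmul2l _ (lee_sum _ (fun i _ => integral_psi_le i))) _.
  by rewrite lee_fin ltW.
set J := (\int[P]_w (f (X (Y w)) - flow + C)%:E)%E.
have J0 : (0 <= J)%E.
  by apply: integral_ge0 => w _; rewrite lee_fin addr_ge0 // subr_ge0.
(* A finite bound equals the mean of its N copies; an infinite one makes the claim trivial. *)
case: J J0 => [r r0|_|//].
  by rewrite sumEFin -EFinM lee_fin avgc.
by rewrite leey.
Qed.

End one_step.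

(** * Sigma-algebras of the past, and iterates as functions of the samples *)

Lemma measurable_sub_sigma (T : pointedType) (d : measure_display)
    (U : measurableType d) (G G' : set (set T)) (h : T -> U) :
  <<s G >> `<=` <<s G' >> ->
  measurable_fun setT (h : g_sigma_algebraType G -> U) ->
  measurable_fun setT (h : g_sigma_algebraType G' -> U).
Proof. by move=> sGG' mh _ A mA; apply: sGG'; exact: mh. Qed.

Lemma measurable_from_sub_sigma (d d' : measure_display) (T : measurableType d)
    (U : measurableType d') (G : set (set T)) (h : T -> U) :
  <<s G >> `<=` measurable ->
  measurable_fun setT (h : g_sigma_algebraType G -> U) -> measurable_fun setT h.
Proof. by move=> sG mh _ A mA; apply: sG; exact: mh. Qed.

(* Iterations are numbered from 1: the value at index 0 is junk. *)
Fixpoint quasi_newton_iterates {R : realType} {n : nat} {T V : Type}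
    (g : 'cV[R]_n -> V -> 'cV[R]_n) (H : nat -> T -> 'M[R]_n)
    (alpha : nat -> R) (N : nat) (xi : nat -> nat -> T -> V) (x1 : 'cV[R]_n)
    (k : nat) (w : T) : 'cV[R]_n :=
  if k isn't k'.+1 then x1 else
  if k' is 0%N then x1 else
  let y := quasi_newton_iterates g H alpha N xi x1 k' w in
  y - alpha k' *: (H k' w *m (N%:R^-1 *: \sum_(i < N) g y (xi k' i w))).

Section history.
Context {R : realType} {d : nat} {dT : measure_display} {T : measurableType dT}
  {P : probability T R}.
Context (bsz : nat -> nat) (xi : nat -> nat -> {RV P >-> 'cV[R]_d}).

(** Only the generators of [sigma_history], so that [g_sigma_algebraType] can put that sigma-algebra
    on [T]. *)
Definition history (k : nat) : set (set T) :=
  \bigcup_(p in sample_index bsz `&` [set p | (p.1 <= k)%N])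
    g_sigma_algebra_preimage (xi p.1 p.2).

Lemma sub_history k l : (k <= l)%N -> <<s history k >> `<=` <<s history l >>.
Proof.
move=> kl; apply: sub_sigma_algebra2 => A [p [sp pk] pA].
by exists p => //; split => //; exact: leq_trans kl.
Qed.

Lemma history_measurable k : <<s history k >> `<=` (@measurable _ T).
Proof.
apply: smallest_sub; first exact: sigma_algebra_measurable.
by move=> A [p _ [B mB <-]]; exact: (measurable_funPT (xi p.1 p.2)) measurableT _ mB.
Qed.

Lemma measurable_sample_history k i : sample_index bsz (k, i) ->
  measurable_fun setT (xi k i : g_sigma_algebraType (history k) -> _).
Proof.
move=> ski _ A mA; apply: sub_sigma_algebra.
by exists (k, i); [split => /=|exists A].
Qed.

End history.

(** * Summation over the iterations and the almost sure conclusion *)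

Theorem theorem2p1 (R : realType) (n d : nat)
    (dT : measure_display) (T : measurableType dT) (P : probability T R)
    (f : 'cV[R]_n -> R) (flow L : R)
    (Xi : set 'cV[R]_d) (G : 'cV[R]_n -> 'cV[R]_d -> 'cV[R]_n)
    (bsz : nat -> nat) (mbar : nat) (x1 : 'cV[R]_n) (B1 : 'M[R]_n)
    (zeta alpha : nat -> R)
    (xi : nat -> nat -> {RV P >-> 'cV[R]_d})
    (B : nat -> T -> 'M[R]_n) (x : nat -> T -> 'cV[R]_n)
    (sigma m M Mbar : R)
    (hf : AS1 f flow L)
    (hG : stochastic_oracle Xi G)
    (hXi : samples_supported_on Xi bsz xi)
    (hx : SQN G bsz x1 B1 zeta alpha xi B x)
    (hmbar : (1 <= mbar)%N)
    (hbsz : forall k, (1 <= k)%N -> bsz k = mbar)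
    (halpha : forall k, (1 <= k)%N -> 0 < alpha k)
    (halpha1 : (\sum_(1 <= k <oo) (alpha k)%:E = +oo)%E)
    (halpha2 : (\sum_(1 <= k <oo) (alpha k ^+ 2)%:E < +oo)%E)
    (h2 : AS2 f sigma Xi G bsz xi x)
    (h3 : AS3 P m M zeta B)
    (h4 : AS4 bsz xi B)
    (hMbar : 0 < Mbar)
    (hbound : {ae P, forall w, forall k, (1 <= k)%N ->
                enorm (grad f (x k w)) <= Mbar}) :
  {ae P, forall w, limn_einf (fun k => (enorm (grad f (x k w)))%:E) = 0%E}.
Proof.
have [mXi mG] := hG.
have [_ x1E B1E _ xS] := hx.
have [_ ind unb var] := h2.
have [m0 M0 hH] := h3.
have [_ fl _ _] := hf.
have sample k i : (1 <= k)%N -> (i < mbar)%N -> sample_index bsz (k, i).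
  by move=> k1 ib; apply/andP; rewrite /= hbsz.
(* [G] is only measurable for samples in [Xi], so the iterates [x k] need not be
   measurable: we work with the iterates [y k] of an oracle patched outside
   [Xi], which agree with [x k] almost surely. *)
pose G' : 'cV[R]_n * 'cV[R]_d -> 'cV[R]_n :=
  (fun z => G z.1 z.2) \_ ([set: 'cV[R]_n] `*` Xi).
have mG' : measurable_fun setT G'.
  exact: (measurable_restrictT _ (measurableX measurableT mXi)).1.
have G'E u z : Xi z -> G' (u, z) = G u z.
  by move=> Xiz; rewrite /G' patchT // inE.
pose g u z := G' (u, z).
pose H k w := invmx (B k w) + (zeta k)%:M.
pose y := quasi_newton_iterates g H alpha mbar (fun k i => xi k i) x1.
have yS k w : (1 <= k)%N -> y k.+1 w = y k w -
    alpha k *: (H k w *m (mbar%:R^-1 *: \sum_(i < mbar) g (y k w) (xi k i w))).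
  by case: k.
have in_Xi : {ae P, forall w, forall k i, sample_index bsz (k, i) -> Xi (xi k i w)}.
  apply: ae_foralln => k; apply: ae_foralln => i.
  have [ski|nski] := pselect (sample_index bsz (k, i)); last first.
    by apply: nearW => w /nski.
  have mxi : measurable (xi k i @^-1` Xi) by exact: measurable_funPTI.
  have nXi : P (~` (xi k i @^-1` Xi)) = 0%E.
    by rewrite probability_setC // [X in (_ - X)%E](hXi _ _ ski) subee.
  exists (~` (xi k i @^-1` Xi)); split => //; first exact: measurableC.
  by move=> w /= nX Xw; apply: nX.
have xy : {ae P, forall w, forall k, (1 <= k)%N -> x k w = y k w}.
  apply: filterS in_Xi => w wXi; elim=> // -[_ _|k IH _]; first by rewrite x1E.
  rewrite xS // yS // -IH // /batch_grad hbsz //; congr (_ - _ *: (_ *m (_ *: _))).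
  by apply: eq_bigr => i _; rewrite /g G'E //; apply: wXi; exact: sample.
pose hist k := history bsz xi k.
(* The matrix used in iteration k is fixed by the samples up to k - 1. AS4 starts at k = 2; for k =
   1 the matrix is the constant [B1]. *)
have mB k : (1 <= k)%N ->
    measurable_fun setT (B k : g_sigma_algebraType (hist k.-1) -> 'M[R]_n).
  case: k => [//|[_|k _]].
    rewrite (_ : B 1%N = cst B1); first exact: measurable_cst.
    exact/funext.
  by move=> _ A mA; apply: h4 => //; exists A.
have mH k : (1 <= k)%N ->
    measurable_fun setT (H k : g_sigma_algebraType (hist k.-1) -> 'M[R]_n).
  move=> k1; apply: measurable_mxD; last exact: measurable_cst.
  by apply: measurable_invmx; exact: mB.
have my k : (1 <= k)%N ->
    measurable_fun setT (y k : g_sigma_algebraType (hist k.-1) -> 'cV[R]_n).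
  case: k => [//|k _]; elim: k => [|k IH]; first exact: measurable_cst.
  (* The update uses samples of iteration k + 1, so the iterate and the matrix are first viewed in
     the larger history. *)
  have IH' : measurable_fun setT
      (y k.+1 : g_sigma_algebraType (hist k.+1) -> 'cV[R]_n).
    by apply: measurable_sub_sigma IH; apply: sub_history.
  have mH' : measurable_fun setT
      (H k.+1 : g_sigma_algebraType (hist k.+1) -> 'M[R]_n).
    by apply: measurable_sub_sigma (mH k.+1 isT); apply: sub_history.
  rewrite /= (_ : y k.+2 = fun w => y k.+1 w + (- alpha k.+1) *: (H k.+1 w *m
      (mbar%:R^-1 *: \sum_(i < mbar) g (y k.+1 w) (xi k.+1 i w)))); last first.
    by apply/funext => w; rewrite yS // scaleNr.
  apply: measurable_mxD => //; apply: measurable_mxZ; apply: measurable_mulmx => //.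
  apply: measurable_mxZ; apply: measurable_mx_sum => i.
  apply: (measurableT_comp mG' (g := (fun w => (y k.+1 w, xi k.+1 i w))
    : g_sigma_algebraType (hist k.+1) -> _)).
  apply: measurable_fun_pair => //.
  by apply: measurable_sample_history; exact: sample.
pose D k w := dot (grad f (y k w)) (grad f (y k w)).
pose F k := (\int[P]_w (f (y k w) - flow)%:E)%E.
pose C := L * M ^+ 2 * (2 * sigma ^+ 2 + 2 * Mbar ^+ 2).
have myT k : (1 <= k)%N -> measurable_fun setT (y k).
  move=> k1; apply: measurable_from_sub_sigma (my k k1).
  exact: history_measurable.
have step k : (1 <= k)%N ->
    (F k.+1 + (alpha k * m)%:E * \int[P]_w (D k w)%:E <=
     F k + (C * alpha k ^+ 2)%:E)%E.
  move=> k1.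
  (* The past is [T] itself with the coarser sigma-algebra and [Y] is the identity: [y k] and [H k]
     are then functions of [Y] without being factored through a vector of samples. *)
  have mid : measurable_fun setT (fun w : T => w : g_sigma_algebraType (hist k.-1)).
    move=> _ A mA; rewrite setTI.
    exact: (@history_measurable R d dT T P bsz xi k.-1 A mA).
  pose Y : {mfun T >-> g_sigma_algebraType (hist k.-1)} :=
    HB.pack (fun w : T => w) (isMeasurableFun.Build _ _ _ _ _ mid).
  have mg : measurable_fun setT (fun z : 'cV[R]_n * 'cV[R]_d => g z.1 z.2).
    by rewrite (_ : (fun _ => _) = G') //; apply/funext => -[].
  have indY (i : 'I_mbar) A E : measurable A -> measurable E ->
      P (Y @^-1` A `&` xi k i @^-1` E) = (P (Y @^-1` A) * P (xi k i @^-1` E))%E.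
    move=> mA mE.
    apply: (mutually_independent_sigma (S := sample_index bsz `&`
      [set p | (p.1 <= k.-1)%N]) (i := (k, nat_of_ord i)) ind) => //.
    + exact: (sample k i k1 (ltn_ord i)).
    + by move=> [_ /=]; rewrite -ltnS prednK // ltnn.
  have XiY (i : 'I_mbar) : distribution P (xi k i) Xi = 1%E.
    exact: (hXi _ _ (sample k i k1 (ltn_ord i))).
  have unbY (i : 'I_mbar) : {ae P, forall w, forall j,
      (\int[distribution P (xi k i)]_(z in Xi) (g (y k (Y w)) z j 0)%:E)%E =
      (grad f (y k (Y w)) j 0)%:E}.
    apply: filterS2 (unb k i (sample k i k1 (ltn_ord i))) xy.
    move=> w uw xyw j; rewrite -xyw // -uw.
    by apply: eq_integral => z; rewrite inE => Xiz; rewrite /g G'E.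
  have varY (i : 'I_mbar) : {ae P, forall w,
      (\int[distribution P (xi k i)]_(z in Xi)
        (enorm (g (y k (Y w)) z - grad f (y k (Y w))) ^+ 2)%:E
      <= (sigma ^+ 2)%:E)%E}.
    apply: filterS2 (var k i (sample k i k1 (ltn_ord i))) xy.
    move=> w vw xyw; rewrite -xyw //; apply: le_trans vw.
    rewrite le_eqVlt; apply/orP; left; apply/eqP.
    by apply: eq_integral => z; rewrite inE => Xiz; rewrite /g G'E.
  have HY : {ae P, forall w,
      loewner_le m%:M (H k (Y w)) /\ loewner_le (H k (Y w)) M%:M}.
    by apply: filterS hH => w; exact.
  have bY : {ae P, forall w, enorm (grad f (y k (Y w))) <= Mbar}.
    by apply: filterS2 hbound xy => w bw xyw; rewrite -xyw // bw.
  have := expected_descent hf (my k k1) (mH k k1) hmbar mXi mg (halpha k k1)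
    m0 M0 indY XiY unbY varY HY bY.
  rewrite (_ : L * (alpha k * M) ^+ 2 * (2 * sigma ^+ 2 + 2 * Mbar ^+ 2) =
    C * alpha k ^+ 2); last by rewrite /C; ring.
  apply: le_trans; rewrite leeD2r // le_eqVlt; apply/orP; left; apply/eqP.
  by apply: eq_integral => w _; rewrite yS.
have D0 k w : 0 <= D k w by exact: dot_ge0.
have F0 k : (0 <= F k)%E.
  by apply: integral_ge0 => w _; rewrite lee_fin subr_ge0.
pose I k := (\int[P]_w (D k w)%:E)%E.
have I0 k : (0 <= I k)%E by apply: integral_ge0 => w _; rewrite lee_fin.
have aI0 k : (1 <= k)%N -> (0 <= (alpha k)%:E * I k)%E.
  by move=> k1; rewrite mule_ge0 // lee_fin ltW // halpha.
have L0 : 0 < L by case: hf.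
have C0 : 0 <= C.
  apply: mulr_ge0; first by apply: mulr_ge0; [exact: ltW|exact: sqr_ge0].
  by apply: addr_ge0; apply: mulr_ge0 => //; exact: sqr_ge0.
have telescope K : (F K.+1 + m%:E * \sum_(1 <= k < K.+1) (alpha k)%:E * I k <=
    F 1%N + C%:E * \sum_(1 <= k < K.+1) (alpha k ^+ 2)%:E)%E.
  elim: K => [|K IH]; first by rewrite !big_geq // !mule0.
  have s0 : (0 <= \sum_(1 <= k < K.+1) (alpha k)%:E * I k)%E.
    by rewrite big_nat; apply: sume_ge0 => i /andP[i1 _]; exact: aI0.
  have q0 : (0 <= \sum_(1 <= k < K.+1) (alpha k ^+ 2)%:E)%E.
    by apply: sume_ge0 => i _; rewrite lee_fin sqr_ge0.
  rewrite (big_nat_recr K.+1) // (big_nat_recr K.+1) //=.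
  rewrite (ge0_muleDr _ s0 (aI0 _ _)) // (ge0_muleDr _ q0) ?lee_fin ?sqr_ge0 //.
  rewrite (addeC (m%:E * _)%E) addeA muleA -EFinM (mulrC m).
  apply: le_trans (leeD2r _ (step K.+1 isT)) _.
  by rewrite addeAC -EFinM addeA leeD2r.
(* The starting point is deterministic, which supplies the one finite expectation from which the
   finiteness of the sum follows. *)
have F1 : (F 1%N < +oo)%E.
  have -> : F 1%N = (\int[P]_w cst (f x1 - flow)%:E w)%E by [].
  rewrite integral_cst // (_ : _ * _ = (f x1 - flow)%:E)%E ?ltry //.
  by rewrite -[RHS]mule1; congr (_ * _)%E; exact: probability_setT.
have sumI : (\sum_(1 <= k <oo) (alpha k)%:E * I k < +oo)%E.
  have sa0 : (0 <= \sum_(1 <= k <oo) (alpha k ^+ 2)%:E)%E.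
    by apply: nneseries_ge0 => k _ _; rewrite lee_fin sqr_ge0.
  have : (F 1%N + C%:E * \sum_(1 <= k <oo) (alpha k ^+ 2)%:E \is a fin_num)%E.
    rewrite fin_numD (ge0_fin_numE (F0 _)) F1 /=.
    by apply: fin_numM => //; rewrite ge0_fin_numE.
  move=> /fineK; set b := fine _ => Eb.
  (* Dropping the nonnegative [F K.+1] from [telescope] and dividing by m bounds all partial sums by
     the same number. *)
  apply: (@le_lt_trans _ _ (m^-1 * b)%:E); last exact: ltry.
  apply: lime_le; first by apply: is_cvg_nneseries => k k1 _; exact: aI0.
  exists 1%N => // -[//|K _]; rewrite EFinM lee_pdivlMl // Eb.
  apply: (@le_trans _ _ (F K.+1 + m%:E * \sum_(1 <= k < K.+1) (alpha k)%:E * I k)%E).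
    by rewrite leeDr.
  apply: le_trans (telescope K) _; rewrite leeD2l // lee_wpmul2l //.
  by apply: nneseries_lim_ge => k _ _; rewrite lee_fin sqr_ge0.
(* Padding index 0 with zero turns the series into one over all naturals, for which integral and
   series are exchanged by monotone convergence. *)
pose t k w : \bar R := if (1 <= k)%N then (alpha k * D k w)%:E else 0%E.
have t0 k w : (0 <= t k w)%E.
  by rewrite /t; case: ifPn => // k1; rewrite lee_fin mulr_ge0 // ltW // halpha.
have mD k : (1 <= k)%N -> measurable_fun setT (fun w => (D k w)%:E).
  move=> k1; apply/measurable_EFinP.
  by apply: measurable_dot; apply: (measurableT_comp (AS1_measurable_grad hf));
    exact: myT.
have mt k : measurable_fun setT (t k).
  case: k => [|k]; first exact: measurable_cst.
  apply/measurable_EFinP; apply: measurable_funM => //.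
  exact/measurable_EFinP/mD.
have series_t (h : nat -> \bar R) : (\sum_(1 <= k <oo) h k =
    \sum_(0 <= k <oo) if (1 <= k)%N then h k else 0)%E.
  by rewrite eseries_cond -eseries_mkcond.
have it : (\int[P]_w (\sum_(0 <= k <oo) t k w) < +oo)%E.
  rewrite integral_nneseries //.
  apply: le_lt_trans sumI; rewrite series_t; apply: lee_nneseries => k.
    by move=> _ _; apply: integral_ge0 => w _.
  case: k => [_|k _]; first by rewrite integral0.
  rewrite /t /=.
  under eq_integral => w _ do rewrite EFinM.
  have a0 : (0 <= (alpha k.+1)%:E)%E by rewrite lee_fin ltW // halpha.
  by rewrite ge0_integralZl // => [|w _]; [exact: mD|rewrite lee_fin].
have st0 w : (0 <= \sum_(0 <= k <oo) t k w)%E by exact: nneseries_ge0.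
have fint : {ae P, forall w, (\sum_(0 <= k <oo) t k w < +oo)%E}.
  have : P.-integrable setT (fun w => \sum_(0 <= k <oo) t k w)%E.
    apply/integrableP; split; first exact: ge0_emeasurable_sum.
    by under eq_integral => w _ do rewrite gee0_abs //; exact: it.
  move=> /(integrable_ae measurableT); apply: filterS => w /(_ Logic.I).
  by rewrite ge0_fin_numE.
(* From here [w] is fixed, and [x] and [y] agree along it from index 1 on, where the series
   starts. *)
apply: filterS2 fint xy => w finw xyw.
apply: (limn_einf_eq0 halpha) => //; first by move=> k; exact: enorm_ge0.
rewrite series_t; move: finw; apply: le_lt_trans.
rewrite le_eqVlt; apply/orP; left; apply/eqP; apply: eq_eseriesr => k _.
by rewrite /t; case: leqP => // k1; rewrite sqr_enorm xyw.
Qed.
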